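(* Let $\mathbb{K}$ be a field in which $2$ is invertible. For each partition diagram $\pi$ let $\eta_\pi:=\sum_{\sigma\ge\pi}2^{l(\sigma)}M_\sigma$ and $L_\pi:=\sum_{\sigma\le\pi}M_\sigma$ in $\mathrm{ParQSym}$. Then: (1) for any partition diagram $\pi$, $$\eta_\pi=2\sum_{\rho:\ \rho\sim\pi}(-1)^{|S(\rho)\setminus S(\pi)|}L_\rho;$$ (2) for any $\pi\in I_n$, $$L_\pi=2^{-n}\sum_{\rho:\ \rho\sim\pi}(-1)^{|S(\pi)\setminus S(\rho)|}\eta_\rho.$$
   Context: **Partition diagrams.** A partition diagram of order $k\ge 0$ is a set partition of $\{1,\dots,k,1',\dots,k'\}$; for $k=0$ the only one is the empty diagram $\emptyset$. For $\pi$ of order $k$ and $\rho$ of order $m$, $\pi\otimes\rho$ is the diagram of order $k+m$ whose blocks are the blocks of $\pi$ and the blocks of $\rho$ with labels shifted by $k$ ($i\mapsto i+k$, $i'\mapsto (i+k)'$). If $k,m\ge1$, $\pi\bullet\rho$ is obtained from $\pi\otimes\rho$ by merging the block containing $k'$ with the block containing $(k+1)'$. The empty diagram is the unit for both operations. A diagram is $\otimes$-irreducible (resp. $\bullet$-irreducible) if it is not $\rho\otimes\sigma$ (resp. $\rho\bullet\sigma$) with $\rho,\sigma$ both non-empty. Every non-empty $\pi$ is uniquely $\pi_1\otimes\cdots\otimes\pi_l$ with all $\pi_i$ non-empty and $\otimes$-irreducible; $l(\pi):=l$, and $l(\emptyset):=0$. **Refinement.** Every non-empty $\pi$ can be uniquely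 written $\pi=\pi_1\divideontimes_1\pi_2\divideontimes_2\cdots\divideontimes_{n-1}\pi_n$ with each $\divideontimes_i\in\{\otimes,\bullet\}$ and each $\pi_i$ non-empty and both $\otimes$- and $\bullet$-irreducible (on non-empty diagrams $\otimes$ and $\bullet$ associate with each other). $I_n$ ($n\ge1$) is the set of diagrams with exactly $n$ such factors, and $I_0=\{\emptyset\}$. Put $S(\pi)=\{i\in\{1,\dots,n-1\}:\divideontimes_i=\otimes\}$, and $S(\emptyset)=\varnothing$. For non-empty $\pi,\sigma$ write $\pi\sim\sigma$ if their sequences $(\pi_1,\dots,\pi_n)$ and $(\sigma_1,\dots,\sigma_m)$ are equal; $\pi\le\sigma$ if $\pi\sim\sigma$ and $S(\sigma)\subseteq S(\pi)$. The empty diagram is related only to itself, with $\emptyset\sim\emptyset$ and $\emptyset\le\emptyset$. **ParQSym** is the $\mathbb{K}$-vector space with basis $\{M_\pi\}$ indexed by all partition diagrams.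
   Formalization: Part (1) is stated and proved only for non-empty π: for π = ∅ it would read M_∅ = 2M_∅, which is false over every field, since l(∅) = 0. Part (2) covers every π, including the empty diagram (n = 0). *)

(* Defs.v *)
From HB Require Import structures.
From mathcomp Require Import all_boot all_order all_algebra.
From mathcomp Require Import finmap monalg.
From mathcomp Require Import zify.
From Stdlib Require Import ClassicalEpsilon.

Set Implicit Arguments.
Unset Strict Implicit.
Unset Printing Implicit Defensive.

Import GRing.Theory.

(* [inl i] stands for the label i+1 and [inr i] for the label (i+1)'. *)
Notation point k := ('I_k + 'I_k)%type.

Definition diagram (k : nat) :=
  {P : {set {set point k}} | partition P [set: point k]}.

HB.instance Definition _ k := Finite.on (diagram k).

Definition blocks k (P : diagram k) : {set {set point k}} := val P.

Definition pdiag := {k : nat & diagram k}.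

HB.instance Definition _ := Choice.on pdiag.

Definition pd_order (p : pdiag) : nat := tag p.

Lemma partition_diagram0 :
  partition (set0 : {set {set point 0}}) [set: point 0].
Proof.
rewrite /partition /cover /trivIset /cover !big_set0 cards0 eqxx in_set0 /= andbT.
by apply/eqP/setP => -[] [].
Qed.

Definition pd_empty : pdiag :=
  Tagged diagram (exist _ set0 partition_diagram0 : diagram 0).

Definition lpoint k m (x : point k) : point (k + m) :=
  match x with inl i => inl (lshift m i) | inr i => inr (lshift m i) end.

Definition rpoint k m (x : point m) : point (k + m) :=
  match x with inl i => inl (rshift k i) | inr i => inr (rshift k i) end.

Arguments lpoint {k} m x.
Arguments rpoint k {m} x.

Definition tensor_blocks k m (P : {set {set point k}}) (Q : {set {set point m}}) :
    {set {set point (k + m)}} :=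
  [set lpoint m @: B | B : {set point k} in P] :|:
  [set rpoint k @: B | B : {set point m} in Q].

Definition merge_blocks (T : finType) (P : {set {set T}}) (x y : T) :
    {set {set T}} :=
  (pblock P x :|: pblock P y) |: [set B in P | (x \notin B) && (y \notin B)].

Lemma partition_setTP (T : finType) (P : {set {set T}}) :
  reflect [/\ forall x, exists2 B, B \in P & x \in B,
              forall A B x, A \in P -> B \in P -> x \in A -> x \in B -> A = B &
              set0 \notin P]
          (partition P [set: T]).
Proof.
apply: (iffP and3P) => [[/eqP cP /trivIsetP tP nP]|[cP tP nP]]; split=> //.
- move=> x; have: x \in cover P by rewrite cP in_setT.
  by case/bigcupP => B BP xB; exists B.
- move=> A B x AP BP xA xB; apply/eqP; apply: contraT => nAB.
  by have /pred0P/(_ x) := tP A B AP BP nAB; rewrite /= xA xB.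
- apply/eqP/setP => x; rewrite in_setT; have [B BP xB] := cP x.
  by apply/bigcupP; exists B.
- apply/trivIsetP => A B AP BP; apply: contraNT => /pred0Pn [x /= /andP [xA xB]].
  by apply/eqP; apply: (tP A B x).
Qed.

Lemma lpoint_inj k m : injective (@lpoint k m).
Proof. by move=> [i|i] [j|j] //= [] e; congr (_ _); apply: val_inj. Qed.

Lemma rpoint_inj k m : injective (@rpoint k m).
Proof. by move=> [i|i] [j|j] //= [] /addnI e; congr (_ _); apply: val_inj. Qed.

Lemma lrpoint_neq k m x y : @lpoint k m x <> @rpoint k m y.
Proof.
by case: x => i; case: y => j //= [] e; have := ltn_ord i; rewrite e ltnNge leq_addr.
Qed.

Lemma lrpoint_split k m (x : point (k + m)) :
  (exists y, x = lpoint m y) \/ (exists y, x = rpoint k y).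
Proof.
by case: x => i; have [j ->|j ->] := split_ordP i;
   [left; exists (inl j)|right; exists (inl j)|left; exists (inr j)|right; exists (inr j)].
Qed.

Lemma mem_lpoint k m (B : {set point k}) x : (lpoint m x \in lpoint m @: B) = (x \in B).
Proof. by rewrite mem_imset //; apply: lpoint_inj. Qed.

Lemma mem_rpoint k m (B : {set point m}) x : (rpoint k x \in rpoint k @: B) = (x \in B).
Proof. by rewrite mem_imset //; apply: rpoint_inj. Qed.

Lemma mem_lrpoint k m (B : {set point m}) x : (lpoint m x \in rpoint k @: B) = false.
Proof. by apply/negP => /imsetP [y _ /lrpoint_neq]. Qed.

Lemma mem_rlpoint k m (B : {set point k}) x : (rpoint k x \in lpoint m @: B) = false.
Proof. by apply/negP => /imsetP [y _ /esym /lrpoint_neq]. Qed.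

Lemma partition_tensor k m (P : diagram k) (Q : diagram m) :
  partition (tensor_blocks (blocks P) (blocks Q)) [set: point (k + m)].
Proof.
have /partition_setTP [cP tP nP] := valP P; have /partition_setTP [cQ tQ nQ] := valP Q.
apply/partition_setTP; split.
- move=> x; case: (lrpoint_split x) => -[y ->].
    have [B BP yB] := cP y; exists (lpoint m @: B); last by rewrite mem_lpoint.
    by rewrite inE imset_f.
  have [B BP yB] := cQ y; exists (rpoint k @: B); last by rewrite mem_rpoint.
  by rewrite inE orbC imset_f.
- move=> A B x; rewrite !inE => /orP [] /imsetP [A' AP ->] /orP [] /imsetP [B' BP ->].
  + case/imsetP => y yA ->; rewrite mem_lpoint => yB.
    by rewrite (tP A' B' y).
  + by case/imsetP => y yA ->; rewrite mem_lrpoint.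
  + by case/imsetP => y yA ->; rewrite mem_rlpoint.
  + case/imsetP => y yA ->; rewrite mem_rpoint => yB.
    by rewrite (tQ A' B' y).
- rewrite inE negb_or; apply/andP; split; apply/imsetP => -[B BP /esym /eqP].
    by rewrite imset_eq0 => /eqP e; rewrite -e BP in nP.
  by rewrite imset_eq0 => /eqP e; rewrite -e BP in nQ.
Qed.

Lemma partition_merge (T : finType) (P : {set {set T}}) (x y : T) :
  partition P [set: T] -> partition (merge_blocks P x y) [set: T].
Proof.
move=> PP; have /and3P [/eqP cvP trP _] := PP.
have /partition_setTP [cP tP nP] := PP.
have inP z : z \in cover P by rewrite cvP in_setT.
have pbP z : pblock P z \in P by rewrite pblock_mem.
have pbz z : z \in pblock P z by rewrite mem_pblock.
apply/partition_setTP; split.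
- move=> z; case: (boolP ((x \in pblock P z) || (y \in pblock P z))) => [xyB|].
    exists (pblock P x :|: pblock P y); first by rewrite !inE eqxx.
    rewrite inE; case/orP: xyB => h; apply/orP; [left|right].
      by rewrite (tP _ _ _ (pbP x) (pbP z) (pbz x) h) pbz.
    by rewrite (tP _ _ _ (pbP y) (pbP z) (pbz y) h) pbz.
  by rewrite negb_or => h; exists (pblock P z); rewrite // !inE pbP h orbT.
- have key z B : B \in P -> x \notin B -> y \notin B ->
      z \in pblock P x :|: pblock P y -> z \in B -> False.
    move=> BP xB yB; rewrite inE => /orP [] h zB.
      by rewrite -(tP _ _ _ (pbP x) BP h zB) pbz in xB.
    by rewrite -(tP _ _ _ (pbP y) BP h zB) pbz in yB.
  move=> A B z; rewrite !inE => /orP [/eqP -> | /and3P [AP xA yA]]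
     /orP [/eqP -> // | /and3P [BP xB yB]].
  + by move=> h1 h2; case: (key z B BP xB yB h1 h2).
  + by move=> h1 h2; case: (key z A AP xA yA h2 h1).
  + exact: tP.
- rewrite !inE (negbTE nP) /= orbF; apply/eqP => /setP /(_ x).
  by rewrite !inE pbz.
Qed.

Definition tensor_diagram k m (P : diagram k) (Q : diagram m) : diagram (k + m) :=
  exist _ (tensor_blocks (blocks P) (blocks Q)) (partition_tensor P Q).

Definition merge_diagram k (P : diagram k) (x y : point k) : diagram k :=
  exist _ (merge_blocks (blocks P) x y) (partition_merge x y (valP P)).

Definition pd_tensor (p q : pdiag) : pdiag :=
  Tagged diagram (tensor_diagram (tagged p) (tagged q)).

Definition pd_bullet (p q : pdiag) : pdiag :=
  match p, q with
  | existT k.+1 P, existT m.+1 Q =>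
      Tagged diagram (merge_diagram (tensor_diagram P Q)
        (lpoint m.+1 (inr ord_max)) (rpoint k.+1 (inr ord0)))
  | existT 0 _, _ => q
  | _, existT 0 _ => p
  end.

Definition tensor_irreducible (p : pdiag) : Prop :=
  ~ exists r s : pdiag, [/\ r != pd_empty, s != pd_empty & p = pd_tensor r s].

Definition bullet_irreducible (p : pdiag) : Prop :=
  ~ exists r s : pdiag, [/\ r != pd_empty, s != pd_empty & p = pd_bullet r s].

(* [tensor_factorization p f]: p is the product f_1 ⊗ ... ⊗ f_l. *)
Definition tensor_factorization (p : pdiag) (f : seq pdiag) : Prop :=
  p = foldr pd_tensor pd_empty f /\
  forall q, q \in f -> q != pd_empty /\ tensor_irreducible q.

(* An operation ⊗ or • is encoded by a boolean, [true] meaning ⊗. *)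
Definition pd_op (t : bool) : pdiag -> pdiag -> pdiag :=
  if t then pd_tensor else pd_bullet.

Definition assemble (f : seq pdiag) (o : seq bool) : pdiag :=
  if f is q :: f' then foldl (fun r x => pd_op x.1 r x.2) q (zip o f')
  else pd_empty.

Definition is_refinement (p : pdiag) (d : seq pdiag * seq bool) : Prop :=
  [/\ p = assemble d.1 d.2, size d.2 = (size d.1).-1 &
      forall q, q \in d.1 ->
        [/\ q != pd_empty, tensor_irreducible q & bullet_irreducible q]].

(* Towards the existence of both factorizations: a diagram is determined by its
   order and the relation "lying in the same block" on its labels, the label
   i+1 being coded by (false, i) and (i+1)' by (true, i). *)

Definition code k (x : point k) : bool * nat :=
  match x with inl i => (false, nat_of_ord i) | inr i => (true, nat_of_ord i) end.

Definition related (p : pdiag) (x y : bool * nat) : bool :=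
  [exists u, exists v, [&& code u == x, code v == y &
     [exists B in blocks (tagged p), (u \in B) && (v \in B)]]].

Lemma code_inj k : injective (@code k).
Proof. by move=> [i|i] [j|j] //= [] e; congr (_ _); apply: val_inj. Qed.

Lemma code_lt k (x : point k) : (code x).2 < k.
Proof. by case: x => i /=. Qed.

Lemma code_surj k (x : bool * nat) : x.2 < k -> exists u : point k, code u = x.
Proof.
by case: x => [[] i] /= h; [exists (inr (Ordinal h))|exists (inl (Ordinal h))].
Qed.

Lemma code_lpoint k m (x : point k) : code (lpoint m x) = code x.
Proof. by case: x. Qed.

Lemma code_rpoint k m (x : point m) : code (rpoint k x) = ((code x).1, k + (code x).2).
Proof. by case: x. Qed.

Lemma relatedE k (P : diagram k) (u v : point k) :
  related (Tagged diagram P) (code u) (code v) =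
  [exists B in blocks P, (u \in B) && (v \in B)].
Proof.
apply/existsP/idP => [[u' /existsP [v' /and3P [/eqP eu /eqP ev]]]|h].
  by rewrite (code_inj eu) (code_inj ev).
by exists u; apply/existsP; exists v; rewrite !eqxx.
Qed.

Lemma related_lt p x y : related p x y -> x.2 < pd_order p /\ y.2 < pd_order p.
Proof.
by case/existsP => u /existsP [v /and3P [/eqP <- /eqP <- _]]; split; apply: code_lt.
Qed.

Lemma relatedC p x y : related p x y = related p y x.
Proof.
by apply/idP/idP => /existsP [u /existsP [v /and3P [a b /existsP [B /and3P [c d e]]]]];
  apply/existsP; exists v; apply/existsP; exists u; rewrite a b /=;
  apply/existsP; exists B; rewrite c d e.
Qed.

Lemma mem_blocksE k (P : diagram k) (B : {set point k}) u : u \in B ->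
  (B \in blocks P) =
  [forall v, (v \in B) == related (Tagged diagram P) (code u) (code v)].
Proof.
move=> uB; have /partition_setTP [cP tP nP] := valP P.
apply/idP/forallP => [BP v|h].
  apply/eqP; rewrite relatedE; apply/idP/exists_inP.
    by move=> vB; exists B; rewrite ?uB ?vB.
  by move=> [C CP /andP [uC vC]]; rewrite (tP B C u).
have [C CP uC] := cP u; rewrite (_ : B = C) //; apply/setP => v.
rewrite (eqP (h v)) relatedE; apply/exists_inP/idP.
  by move=> [D DP /andP [uD vD]]; rewrite (tP C D u).
by move=> vC; exists C; rewrite ?uC.
Qed.

Lemma pd_ext p q : pd_order p = pd_order q ->
  (forall x y, x.2 < pd_order p -> y.2 < pd_order p -> related p x y = related q x y) ->
  p = q.
Proof.
case: p q => k P [m Q]; rewrite /pd_order /= => e; case: m / e Q => Q h.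
congr (existT _ _ _); apply: val_inj; apply/setP => B.
have /partition_setTP [_ _ nP] := valP P; have /partition_setTP [_ _ nQ] := valP Q.
have [->|[u uB]] := set_0Vmem B; first by rewrite (negbTE nP) (negbTE nQ).
rewrite -!/(blocks _) !(mem_blocksE _ uB); apply: eq_forallb => v.
by congr (_ == _); apply: h; apply: code_lt.
Qed.

Lemma pd_emptyE p : (p == pd_empty) = (pd_order p == 0).
Proof.
apply/eqP/eqP => [-> //|e]; apply: pd_ext => //.
by move=> x y; rewrite e.
Qed.

Lemma order_tensor p q : pd_order (pd_tensor p q) = pd_order p + pd_order q.
Proof. by []. Qed.

Lemma order_bullet p q : pd_order (pd_bullet p q) = pd_order p + pd_order q.
Proof. by case: p q => [[|k] P] [[|m] Q] //=; rewrite /pd_order /= addn0. Qed.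

Lemma order_op t p q : pd_order (pd_op t p q) = pd_order p + pd_order q.
Proof. by case: t; [apply: order_tensor|apply: order_bullet]. Qed.

Lemma related_tensorLL k m (P : diagram k) (Q : diagram m) u v :
  [exists B in tensor_blocks (blocks P) (blocks Q), (lpoint m u \in B) && (lpoint m v \in B)]
   = [exists B in blocks P, (u \in B) && (v \in B)].
Proof.
apply/exists_inP/exists_inP => -[B].
  rewrite inE => /orP [] /imsetP [A AP ->]; rewrite ?mem_lrpoint // !mem_lpoint.
  by exists A.
by move=> BP h; exists (lpoint m @: B); rewrite ?mem_lpoint // inE imset_f.
Qed.

Lemma related_tensorRR k m (P : diagram k) (Q : diagram m) u v :
  [exists B in tensor_blocks (blocks P) (blocks Q), (rpoint k u \in B) && (rpoint k v \in B)]
   = [exists B in blocks Q, (u \in B) && (v \in B)].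
Proof.
apply/exists_inP/exists_inP => -[B].
  rewrite inE => /orP [] /imsetP [A AP ->]; rewrite ?mem_rlpoint // !mem_rpoint.
  by exists A.
by move=> BP h; exists (rpoint k @: B); rewrite ?mem_rpoint // inE orbC imset_f.
Qed.

Lemma related_tensorLR k m (P : diagram k) (Q : diagram m) u v :
  [exists B in tensor_blocks (blocks P) (blocks Q), (lpoint m u \in B) && (rpoint k v \in B)]
   = false.
Proof.
apply/exists_inP => -[B].
by rewrite inE => /orP [] /imsetP [A AP ->]; rewrite ?mem_lrpoint // ?mem_rlpoint ?andbF.
Qed.

Lemma related_tensorRL k m (P : diagram k) (Q : diagram m) u v :
  [exists B in tensor_blocks (blocks P) (blocks Q), (rpoint k v \in B) && (lpoint m u \in B)]
   = false.
Proof.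
by rewrite -[RHS](related_tensorLR P Q u v); apply: eq_existsb => B; rewrite [X in _ && X]andbC.
Qed.

Lemma related_merge (T : finType) (P : {set {set T}}) (x y u v : T) :
  partition P [set: T] ->
  let R u v := [exists B in P, (u \in B) && (v \in B)] in
  [exists B in merge_blocks P x y, (u \in B) && (v \in B)] =
  [|| R u v, R u x && R v y | R u y && R v x].
Proof.
move=> PP R; have /and3P [/eqP cvP trP _] := PP.
have /partition_setTP [cP tP nP] := PP.
have inP z : z \in cover P by rewrite cvP in_setT.
have pbP z : pblock P z \in P by rewrite pblock_mem.
have pbz z : z \in pblock P z by rewrite mem_pblock.
have RE a b : R a b = (a \in pblock P b).
  apply/exists_inP/idP => [[B BP /andP [aB bB]]|h]; last first.
    by exists (pblock P b); rewrite ?h ?pbz.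
  by rewrite (tP _ _ _ (pbP b) BP (pbz b) bB).
have Rtr a b c : a \in pblock P c -> b \in pblock P c -> R a b.
  by move=> h1 h2; apply/exists_inP; exists (pblock P c); rewrite ?h1 ?h2.
apply/exists_inP/idP => [[B]|].
  rewrite !inE => /orP [/eqP -> | /andP [BP _] /andP [uB vB]]; last first.
    by apply/orP; left; apply/exists_inP; exists B; rewrite ?uB ?vB.
  rewrite !inE -!RE => /andP [].
  case/orP => h1; case/orP => h2; rewrite h1 h2 ?orbT //.
    by rewrite (@Rtr u v x) // -RE.
  by rewrite (@Rtr u v y) // -RE.
case/or3P; last 2 first.
- move=> /andP []; rewrite !RE => h1 h2.
  by exists (pblock P x :|: pblock P y); rewrite !inE ?eqxx ?h1 ?h2 ?orbT.
- move=> /andP []; rewrite !RE => h1 h2.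
  by exists (pblock P x :|: pblock P y); rewrite !inE ?eqxx ?h1 ?h2 ?orbT.
case/exists_inP => B BP /andP [uB vB].
case: (boolP ((x \notin B) && (y \notin B))) => [h|].
  by exists B; rewrite ?uB ?vB // !inE BP h orbT.
rewrite negb_and !negbK => h; exists (pblock P x :|: pblock P y); first by rewrite !inE eqxx.
case/orP: h => h; rewrite !inE.
  by rewrite !(tP _ _ _ (pbP x) BP (pbz x) h) uB vB.
by rewrite !(tP _ _ _ (pbP y) BP (pbz y) h) uB vB !orbT.
Qed.

Definition shift (k : nat) (x : bool * nat) : bool * nat := (x.1, k + x.2).

Definition lastp p : bool * nat := (true, (pd_order p).-1).
Definition firstp : bool * nat := (true, 0).

Section Related.
Variables (t : bool) (p q : pdiag).
Hypotheses (p0 : 0 < pd_order p) (q0 : 0 < pd_order q).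

Lemma related_op :
  [/\ forall x y, x.2 < pd_order p -> y.2 < pd_order p ->
        related (pd_op t p q) x y = related p x y,
      forall x y, x.2 < pd_order q -> y.2 < pd_order q ->
        related (pd_op t p q) (shift (pd_order p) x) (shift (pd_order p) y)
        = related q x y &
      forall x y, x.2 < pd_order p -> y.2 < pd_order q ->
        related (pd_op t p q) x (shift (pd_order p) y)
        = [&& ~~ t, related p x (lastp p) & related q firstp y]].
Proof.
case: p q p0 q0 => [[|k] P] [[|m] Q] // _ _; rewrite /pd_order /=.
have shiftE (v : point m.+1) : shift k.+1 (code v) = code (rpoint k.+1 v).
  by rewrite code_rpoint.
have lastE : lastp (Tagged diagram P) = code (inr ord_max : point k.+1) by [].
have firstE : firstp = code (inr ord0 : point m.+1) by [].
have lE : inr (lshift m.+1 ord_max) = lpoint m.+1 (inr ord_max : point k.+1) by [].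
have rE : inr (rshift k.+1 ord0) = rpoint k.+1 (inr ord0 : point m.+1) by [].
have LE (v : point k.+1) : code v = code (lpoint m.+1 v) by rewrite code_lpoint.
case: t => /=; split=> x y hx hy; have [u <-] := code_surj hx; have [v <-] := code_surj hy;
  rewrite ?lastE ?firstE ?shiftE.
- by rewrite {1}(LE u) {1}(LE v) !relatedE related_tensorLL.
- by rewrite !relatedE related_tensorRR.
- by rewrite {1}(LE u) relatedE related_tensorLR.
- rewrite {1}(LE u) {1}(LE v) !relatedE.
  rewrite related_merge ?partition_tensor // lE rE !related_tensorLL !related_tensorLR.
  by rewrite !andbF !orbF.
- rewrite !relatedE related_merge ?partition_tensor // lE rE !related_tensorRR !related_tensorRL.
  by rewrite !andbF !orbF.
- rewrite {1}(LE u) !relatedE.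
  rewrite related_merge ?partition_tensor // lE rE !related_tensorLR !related_tensorLL.
  rewrite !related_tensorRR /= orbF; congr (_ && _).
  by apply: eq_existsb => B; rewrite [X in _ && X]andbC.
Qed.
End Related.

Lemma lastp_op t p q : 0 < pd_order q ->
  lastp (pd_op t p q) = shift (pd_order p) (lastp q).
Proof. by move=> q0; rewrite /lastp order_op /shift /=; congr (_, _); lia. Qed.

Lemma pd_opA t u a b c : 0 < pd_order a -> 0 < pd_order b -> 0 < pd_order c ->
  pd_op u (pd_op t a b) c = pd_op t a (pd_op u b c).
Proof.
move=> a0 b0 c0.
have ab0 : 0 < pd_order (pd_op t a b) by rewrite order_op; lia.
have bc0 : 0 < pd_order (pd_op u b c) by rewrite order_op; lia.
have [L1 R1 M1] := related_op t a0 b0; have [L2 R2 M2] := related_op u b0 c0.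
have [L3 R3 M3] := related_op u ab0 c0; have [L4 R4 M4] := related_op t a0 bc0.
have oab : pd_order (pd_op t a b) = pd_order a + pd_order b by rewrite order_op.
have obc : pd_order (pd_op u b c) = pd_order b + pd_order c by rewrite order_op.
have eab y : shift (pd_order a) (shift (pd_order b) y) = shift (pd_order (pd_op t a b)) y.
  by rewrite oab /shift /= addnA.
have split3 x : x.2 < pd_order (pd_op u (pd_op t a b) c) ->
    [\/ x.2 < pd_order a, exists2 y, y.2 < pd_order b & x = shift (pd_order a) y |
        exists2 y, y.2 < pd_order c & x = shift (pd_order a) (shift (pd_order b) y)].
  case: x => e i; rewrite !order_op /= => hi.
  case: (ltnP i (pd_order a)) => h1; first by constructor 1.
  case: (ltnP i (pd_order a + pd_order b)) => h2.
    constructor 2; exists (e, i - pd_order a); first by rewrite /=; lia.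
    by rewrite /shift /= subnKC.
  constructor 3; exists (e, i - pd_order a - pd_order b); first by rewrite /=; lia.
  by rewrite /shift /=; congr (_, _); lia.
have shl p n (y : bool * nat) : y.2 < p -> (shift n y).2 < n + p.
  by rewrite /= ltn_add2l.
have lw p n m : p < n -> p < n + m by move=> h; rewrite ltn_addr.
have last_lt p : 0 < pd_order p -> (lastp p).2 < pd_order p.
  by move=> p0; rewrite /lastp /=; lia.
have main x y : (x.2 < pd_order a \/ (exists2 y, y.2 < pd_order b & x = shift (pd_order a) y) /\
       ~ (y.2 < pd_order a)
    \/ exists2 z, z.2 < pd_order c & x = shift (pd_order a) (shift (pd_order b) z) /\
       exists2 z', z'.2 < pd_order c & y = shift (pd_order a) (shift (pd_order b) z')) ->
    [\/ y.2 < pd_order a, exists2 z, z.2 < pd_order b & y = shift (pd_order a) z |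
        exists2 z, z.2 < pd_order c & y = shift (pd_order a) (shift (pd_order b) z)] ->
    related (pd_op u (pd_op t a b) c) x y = related (pd_op t a (pd_op u b c)) x y.
  case=> [hx|[[[x' hx ->] ny]|[x' hx [-> [y' hy ->]]] _]]; last first.
  - by rewrite R4 ?obc ?shl // R2 // !eab R3.
  - case=> [//|[y' hy ->]|[y' hy ->]].
      by rewrite L3 ?oab ?shl // R1 // R4 ?obc ?lw // L2.
    rewrite R4 ?obc ?shl ?lw // M2 // eab M3 ?oab ?shl // lastp_op //.
    by rewrite R1 // last_lt.
  - case=> [hy|[y' hy ->]|[y' hy ->]].
    + by rewrite L3 ?oab ?lw // L1 // L4.
    + rewrite L3 ?oab ?shl ?lw // M1 // M4 ?obc ?lw //.
      by rewrite L2.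
    + rewrite M4 ?obc ?shl // M2 // eab M3 ?oab ?lw // lastp_op // M1 ?last_lt //.
      by case: (~~ t); case: (~~ u); rewrite ?andbF //= ?andbA.
apply: pd_ext; first by rewrite !order_op addnA.
move=> x y /split3 hx hy; have /split3 hy' := hy.
case: (hx) => [h|h|h].
- by apply: main => //; left.
- case: (ltnP y.2 (pd_order a)) => hya.
    by rewrite relatedC [RHS]relatedC; apply: main => //; left.
  by apply: main => //; right; left; split=> //; apply/negP; rewrite -leqNgt.
- case: (hy') => [h'|h'|h'].
  + by rewrite relatedC [RHS]relatedC; apply: main => //; left.
  + rewrite relatedC [RHS]relatedC; apply: main => //; right; left; split=> //.
    by case: h => z _ -> /=; lia.
  + case: h h' => z hz ez [z' hz' ez']; apply: main => //; right; right.
    by exists z => //; split=> //; exists z'.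
Qed.

Lemma order_gt0 p : (0 < pd_order p) = (p != pd_empty).
Proof. by rewrite pd_emptyE lt0n. Qed.

Lemma pd_op0 t p : pd_op t p pd_empty = p.
Proof.
case: t => /=; last by case: p => [[|k] P] //=; apply/esym/eqP; rewrite pd_emptyE.
apply: pd_ext => [|x y]; first by rewrite order_tensor /pd_order /= addn0.
rewrite order_tensor {1 2}/pd_order /= addn0 => hx hy.
case: p hx hy => k P; rewrite /pd_order /= => hx hy.
have [u <-] := code_surj hx; have [v <-] := code_surj hy.
by rewrite -{1}(code_lpoint 0 u) -{1}(code_lpoint 0 v) !relatedE related_tensorLL.
Qed.

Lemma pd_tensor0 p : pd_tensor p pd_empty = p.
Proof. exact: (pd_op0 true). Qed.

Lemma assemble_cat f1 f2 o1 o2 t :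
  f1 != [::] -> f2 != [::] -> size o1 = (size f1).-1 ->
  (forall q, q \in f1 ++ f2 -> q != pd_empty) ->
  assemble (f1 ++ f2) (o1 ++ t :: o2) = pd_op t (assemble f1 o1) (assemble f2 o2).
Proof.
case: f1 f2 => [|a f1] // [|b f2] // _ _ /= e ne.
have le s (r : pdiag) o : 0 < pd_order r ->
    0 < pd_order (foldl (fun r x => pd_op x.1 r x.2) r (zip o s)).
  elim: s o r => [|c s IH] [|v o] r r0 //=.
  by apply: IH; rewrite order_op ltn_addr.
rewrite zip_cat // foldl_cat /=; move: (foldl _ a _) (le f1 a o1) => r r0.
have {}r0 : 0 < pd_order r by apply: r0; rewrite order_gt0 ne // mem_head.
have {}ne q : q \in b :: f2 -> 0 < pd_order q.
  move=> h; rewrite order_gt0; apply: ne.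
  by rewrite in_cons; apply/orP; right; rewrite mem_cat; apply/orP; right.
have b0 : 0 < pd_order b by rewrite ne ?mem_head.
have {}ne q : q \in f2 -> 0 < pd_order q.
  by move=> h; apply: ne; rewrite in_cons; apply/orP; right.
elim: f2 o2 b b0 ne => [|c f2 IH] [|v o2] b b0 ne //=.
have c0 : 0 < pd_order c by rewrite ne ?mem_head.
rewrite pd_opA // IH // ?order_op ?ltn_addr // => q h.
by apply: ne; rewrite in_cons; apply/orP; right.
Qed.

Lemma refinement_exists p : exists d, is_refinement p d.
Proof.
have [->|] := eqVneq p pd_empty; first by exists ([::], [::]).
elim: (pd_order p).+1 {-2}p (ltnSn (pd_order p)) => // n IH {}p hp p0.
have step t r s : r != pd_empty -> s != pd_empty -> p = pd_op t r s ->
    exists d, is_refinement p d.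
  move=> r0 s0 e; move: hp; rewrite e order_op ltnS.
  have := r0; have := s0; rewrite -!order_gt0 => s1 r1 hp.
  have [|//|[f1 o1] [/= e1 z1 h1]] := IH r; first by lia.
  have [|//|[f2 o2] [/= e2 z2 h2]] := IH s; first by lia.
  have f10 : f1 != [::] by apply: contraNneq r0 => f0; rewrite e1 f0.
  have f20 : f2 != [::] by apply: contraNneq s0 => f0; rewrite e2 f0.
  exists (f1 ++ f2, o1 ++ t :: o2); split=> /=.
  - rewrite assemble_cat // -?e1 -?e2 // => q.
    by rewrite mem_cat => /orP [/h1|/h2] [].
  - rewrite !size_cat /= z1 z2; case: f1 f10 {e1 z1 h1} => // a f1 _.
    by case: f2 f20 {e2 z2 h2} => // b f2 _ /=; rewrite addnS.
  - by move=> q; rewrite mem_cat => /orP [/h1|/h2].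
case: (classic (tensor_irreducible p)) => [it|/NNPP [r [s [r0 s0 e]]]]; last exact: (step true r s).
case: (classic (bullet_irreducible p)) => [ib|/NNPP [r [s [r0 s0 e]]]]; last exact: (step false r s).
by exists ([:: p], [::]); split=> //= q; rewrite mem_seq1 => /eqP ->.
Qed.

Lemma tensor_factorization_exists p : exists f, tensor_factorization p f.
Proof.
elim: (pd_order p).+1 {-2}p (ltnSn (pd_order p)) => // n IH {}p hp.
have [->|p0] := eqVneq p pd_empty; first by exists [::].
case: (classic (tensor_irreducible p)) => [it|/NNPP [r [s [r0 s0 e]]]].
  by exists [:: p]; split=> [|q]; [rewrite /= pd_tensor0|rewrite mem_seq1 => /eqP ->].
move: hp; rewrite e order_tensor ltnS.
have := r0; have := s0; rewrite -!order_gt0 => s1 r1 hp.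
have [|f1 [e1 h1]] := IH r; first by lia.
have [|f2 [e2 h2]] := IH s; first by lia.
exists (f1 ++ f2); split=> [|q]; last by rewrite mem_cat => /orP [/h1|/h2].
rewrite foldr_cat -e2 e1.
have {}h1 q : q \in f1 -> 0 < pd_order q by move=> /h1 []; rewrite order_gt0.
rewrite {}e1 {IH e r0 hp h2 e2 f2 p p0} in r1 *.
elim: f1 r1 h1 => [|a f1 IH] //= _ h1.
have a0 : 0 < pd_order a by rewrite h1 ?mem_head.
have {}h1 q : q \in f1 -> 0 < pd_order q by move=> h; apply: h1; rewrite in_cons; apply/orP; right.
case: f1 IH h1 => [|b f1] IH h1; first by rewrite /= pd_tensor0.
have f0 : 0 < pd_order (foldr pd_tensor pd_empty (b :: f1)).
  rewrite -[foldr _ _ _]/(pd_tensor b (foldr pd_tensor pd_empty f1)).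
  by rewrite order_tensor ltn_addr // h1 ?mem_head.
move: f0 (IH f0 h1); set F := foldr _ _ (b :: f1) => f0 <-.
exact: (pd_opA true true).
Qed.

Definition pd_length (p : pdiag) : nat :=
  size (sval (constructive_indefinite_description _ (tensor_factorization_exists p))).

Definition pd_refinement (p : pdiag) : seq pdiag * seq bool :=
  sval (constructive_indefinite_description _ (refinement_exists p)).

Lemma refinementP p : is_refinement p (pd_refinement p).
Proof. exact: svalP (constructive_indefinite_description _ _). Qed.

Definition pd_factors (p : pdiag) : seq pdiag := (pd_refinement p).1.

Definition pd_operations (p : pdiag) : seq bool := (pd_refinement p).2.

(* The empty diagram has no factors, so it is the only element of [pd_I 0] and,
   below, it is related only to itself by [pd_sim] and [pd_le]. *)
Definition pd_I (n : nat) : {pred pdiag} := fun p => size (pd_factors p) == n.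

(* The i-th operation is stored at index i-1. *)
Definition pd_S (p : pdiag) : {fset nat} :=
  [fset i in iota 1 (size (pd_factors p)).-1 | nth false (pd_operations p) i.-1]%fset.

Definition pd_sim (p q : pdiag) : bool := pd_factors p == pd_factors q.

Definition pd_le (p q : pdiag) : bool := pd_sim p q && (pd_S q `<=` pd_S p)%fset.

Lemma order_factors p : pd_order p = sumn (map pd_order (pd_factors p)).
Proof.
have H f o : size o = (size f).-1 -> pd_order (assemble f o) = sumn (map pd_order f).
  case: f => [|a f] //=.
  elim: f a o => [|b f IH] a [|t o] //= => [_|[e]]; first by rewrite addn0.
  by rewrite IH // order_op addnA.
by case: (refinementP p) => e /H; rewrite -e.
Qed.

(* Hence the sums below, over diagrams of the same order as [p], range over all
   diagrams related to [p]. *)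
Lemma pd_sim_order p q : pd_sim p q -> pd_order p = pd_order q.
Proof. by move=> /eqP e; rewrite !order_factors e. Qed.

Local Open Scope ring_scope.

Definition ParQSym (K : fieldType) := {malg K[pdiag]}.

HB.instance Definition _ (K : fieldType) := GRing.Lmodule.on (ParQSym K).

Definition M_ (K : fieldType) (p : pdiag) : ParQSym K := << p >>.

Definition eta_ (K : fieldType) (p : pdiag) : ParQSym K :=
  \sum_(s : diagram (pd_order p) | pd_le p (Tagged diagram s))
     2%:R ^+ pd_length (Tagged diagram s) *: M_ K (Tagged diagram s).

Definition L_ (K : fieldType) (p : pdiag) : ParQSym K :=
  \sum_(s : diagram (pd_order p) | pd_le (Tagged diagram s) p)
     M_ K (Tagged diagram s).

(* Main.v *)
(** If a ⊗/• c = b ⊗/• d with a of smaller order than b, then restricting the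
    diagram to the columns of b lying to the right of a splits b at the end of a
    by the same operation.  Hence refinements into irreducibles are unique, and
    the diagrams related to p correspond to the subsets S of {1, ..., n-1}; since
    ⊗-irreducible diagrams use only • in their refinement, l(p) = |S(p)| + 1 when
    p is not empty.  Both identities then reduce to the signed count
    [\sum_(T \subset B) (-1)^|T \ A|], which vanishes unless [B \subset A]. *)

Require Import Defs.
From HB Require Import structures.
From mathcomp Require Import all_boot all_order all_algebra.
From mathcomp Require Import finmap monalg zify.
From Stdlib Require Import ClassicalEpsilon.

Set Implicit Arguments.
Unset Strict Implicit.
Unset Printing Implicit Defensive.

Import GRing.Theory.

(** * Restriction of a diagram to an interval of columns *)

Lemma related_refl p x : x.2 < pd_order p -> related p x x.
Proof.
case: p => k P /= hx; have [u <-] := code_surj hx.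
have /partition_setTP [cP _ _] := valP P; have [B BP uB] := cP u.
by rewrite relatedE; apply/exists_inP; exists B; rewrite ?uB.
Qed.

Lemma related_trans p y x z : related p x y -> related p y z -> related p x z.
Proof.
move=> h1 h2; have [hx hy] := related_lt h1; have [_ hz] := related_lt h2.
case: p h1 h2 hx hy hz => k P h1 h2 hx hy hz; move: h1 h2.
have [u <-] := code_surj hx; have [v <-] := code_surj hy; have [w <-] := code_surj hz.
rewrite !relatedE => /exists_inP [A AP /andP [uA vA]] /exists_inP [B BP /andP [vB wB]].
have /partition_setTP [_ tP _] := valP P.
by apply/exists_inP; exists A => //; rewrite uA (tP A B v).
Qed.

(** Lying in a common block of [p] is an equivalence relation on the labels of any interval of
    columns, and its classes form a diagram. *)
Lemma slice_exists p i n : i + n <= pd_order p ->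
  exists2 e, pd_order e = n &
    forall x y, x.2 < n -> y.2 < n -> related e x y = related p (shift i x) (shift i y).
Proof.
move=> h; pose R : rel (point n) := fun u v => related p (shift i (code u)) (shift i (code v)).
have sh x : x.2 < n -> (shift i x).2 < pd_order p by rewrite /shift /=; lia.
have eqR : {in [set: point n] & &, equivalence_rel R}.
  move=> x y z _ _ _; split=> [|xy]; first by rewrite /R related_refl ?sh ?code_lt.
  apply/idP/idP; last exact: related_trans.
  by apply: related_trans; rewrite relatedC.
have PP := equivalence_partitionP eqR.
exists (Tagged diagram (exist (fun P => is_true (partition P [set: point n])) _ PP)) => // x y hx hy.
have [u <-] := code_surj hx; have [v <-] := code_surj hy.
rewrite relatedE -[RHS]/(R u v) -(pblock_equivalence_partition eqR) ?inE //.
rewrite /blocks /=; move: (equivalence_partition _ _) PP => P PP.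
have /and3P [/eqP cvP _ _] := PP; have /partition_setTP [_ tP _] := PP.
have uP : u \in pblock P u by rewrite mem_pblock cvP inE.
apply/exists_inP/idP => [[B BP /andP [uB vB]]|vu]; last first.
  by exists (pblock P u); rewrite ?uP // pblock_mem // cvP inE.
by rewrite (tP (pblock P u) B u) // pblock_mem // cvP inE.
Qed.

Lemma shiftP (x : bool * nat) i n : x.2 < i + n ->
  x.2 < i \/ exists2 y, y.2 < n & x = shift i y.
Proof.
move=> h; case: (ltnP x.2 i) => hx; [by left|right].
by exists (x.1, x.2 - i); rewrite /shift /= ?subnKC; [lia|case: x {h hx}|].
Qed.

(** * Splitting and cancellation in products of diagrams *)

Lemma firstp_lt p : 0 < pd_order p -> firstp.2 < pd_order p.
Proof. by []. Qed.

Lemma lastp_lt p : 0 < pd_order p -> (lastp p).2 < pd_order p.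
Proof. by rewrite /lastp /=; lia. Qed.

Lemma pd_op_split t u a b c d : 0 < pd_order a -> 0 < pd_order c -> 0 < pd_order d ->
  pd_op t a c = pd_op u b d -> pd_order a < pd_order b ->
  exists2 e, e != pd_empty & b = pd_op t a e.
Proof.
move=> a0 c0 d0 E lt; have b0 : 0 < pd_order b by lia.
have [La Ra Ma] := related_op t a0 c0; have [Lb Rb Mb] := related_op u b0 d0.
have oE : pd_order a + pd_order c = pd_order b + pd_order d by have := congr1 pd_order E; rewrite !order_op.
have [|e oe he] := @slice_exists b (pd_order a) (pd_order b - pd_order a); first by lia.
have e0 : 0 < pd_order e by lia.
exists e; first by rewrite -Defs.order_gt0.
have [Le Re Me] := related_op t a0 e0.
have ab x : x.2 < pd_order a -> x.2 < pd_order b by lia.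
have ec x : x.2 < pd_order e -> x.2 < pd_order c by lia.
have eb x : x.2 < pd_order e -> (shift (pd_order a) x).2 < pd_order b by rewrite /shift /=; lia.
(* The columns of [e] lie in both [b] and [c], so in the common product [e] and [c] agree there.
   Hence [a] is joined to [e] inside [b] exactly as it is joined to [c]. *)
have hec y : y.2 < pd_order e -> related e firstp y = related c firstp y.
  by move=> hy; rewrite he -?oe // -Lb ?eb // -E Ra ?ec.
have key x y : x.2 < pd_order a -> y.2 < pd_order e ->
    related b x (shift (pd_order a) y) = related (pd_op t a e) x (shift (pd_order a) y).
  by move=> hx hy; rewrite -Lb ?eb ?ab // -E Ma ?ec // Me // hec.
have oae : pd_order b = pd_order a + pd_order e by lia.
apply: pd_ext; rewrite ?order_op // => x y; rewrite !oae.
move=> /shiftP [hx|[x' hx ->]] /shiftP [hy|[y' hy ->]].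
- by rewrite Le // -La // E Lb ?ab.
- exact: key.
- by rewrite relatedC [RHS]relatedC key.
- by rewrite Re // he -?oe.
Qed.

(** Once the orders agree, both factors are read off from the left and right columns of the
    product. *)
Lemma pd_op_inj t u a b c d : 0 < pd_order a -> 0 < pd_order c -> 0 < pd_order d ->
  pd_op t a c = pd_op u b d -> pd_order a = pd_order b -> [/\ t = u, a = b & c = d].
Proof.
move=> a0 c0 d0 E oab; have b0 : 0 < pd_order b by rewrite -oab.
have [La Ra Ma] := related_op t a0 c0; have [Lb Rb Mb] := related_op u b0 d0.
have oE : pd_order a + pd_order c = pd_order b + pd_order d by have := congr1 pd_order E; rewrite !order_op.
have ab : a = b.
  by apply: pd_ext => // x y hx hy; rewrite -La // E Lb -?oab.
have cd : c = d.
  apply: pd_ext; first by lia.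
  by move=> x y hx hy; rewrite -Ra // E oab Rb //; lia.
(* By reflexivity, the last primed label of the left factor and the first primed label of the right
   one are related in the product exactly when the operation is •, which recovers the operation. *)
split=> //; have := Mb (lastp b) firstp (lastp_lt b0) (firstp_lt d0).
rewrite -E -oab -ab -cd Ma ?lastp_lt // !related_refl ?lastp_lt // !andbT.
by move/negb_inj.
Qed.

(** * Uniqueness of the refinement *)

Lemma order_assemble f o : size o = (size f).-1 ->
  pd_order (assemble f o) = sumn (map pd_order f).
Proof.
case: f => [|a f] //=.
elim: f a o => [|b f IH] a [|t o] //= => [_|[e]]; first by rewrite addn0.
by rewrite IH // order_op addnA.
Qed.

Lemma assemble_gt0 f o : size o = (size f).-1 -> f != [::] ->
  (forall q, q \in f -> q != pd_empty) -> 0 < pd_order (assemble f o).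
Proof.
move=> /order_assemble -> ; case: f => [|a f] //= _ h.
by rewrite ltn_addr // Defs.order_gt0 h // mem_head.
Qed.

Lemma assemble_cons a b f t o :
  (forall q, q \in a :: b :: f -> q != pd_empty) ->
  assemble (a :: b :: f) (t :: o) = pd_op t a (assemble (b :: f) o).
Proof. exact: (@assemble_cat [:: a] (b :: f) [::] o t). Qed.

Definition irreducible (q : pdiag) :=
  [/\ q != pd_empty, tensor_irreducible q & bullet_irreducible q].

Lemma irreducible_op t q a b : irreducible q -> 0 < pd_order a -> 0 < pd_order b ->
  q <> pd_op t a b.
Proof.
rewrite !Defs.order_gt0 => -[_ it ib] a0 b0 e.
by case: t e => e; [apply: it|apply: ib]; exists a, b.
Qed.

(** Compare the first factors: if their orders differ, [pd_op_split] decomposes the larger one,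
    against irreducibility; if they agree, [pd_op_inj] cancels them and the induction continues. *)
Lemma refinement_unique p d1 d2 : is_refinement p d1 -> is_refinement p d2 -> d1 = d2.
Proof.
have tl (a : pdiag) (f : seq pdiag) : (forall q, q \in a :: f -> irreducible q) ->
    (forall q, q \in f -> irreducible q).
  by move=> h q qf; apply: h; rewrite in_cons qf orbT.
have ne (f : seq pdiag) : (forall q, q \in f -> irreducible q) -> (forall q, q \in f -> q != pd_empty).
  by move=> h q /h [].
case: d1 d2 => [f1 o1] [f2 o2] [/= e1 s1 h1] [/= e2 s2 h2].
elim: f1 f2 o1 o2 p e1 s1 h1 e2 s2 h2 => [|a f1 IH] [|b f2] o1 o2 p e1 s1 h1 e2 s2 h2.
- by case: o1 o2 s1 s2 {e1 e2} => [] // [].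
- have := assemble_gt0 s2 isT (ne _ h2); rewrite -e2 e1 //.
- have := assemble_gt0 s1 isT (ne _ h1); rewrite -e1 e2 //.
have irra := h1 a (mem_head _ _); have irrb := h2 b (mem_head _ _).
have a0 : 0 < pd_order a by rewrite Defs.order_gt0; case: irra.
have b0 : 0 < pd_order b by rewrite Defs.order_gt0; case: irrb.
(* If exactly one list is a singleton, then [p] is at once irreducible and a product of two
   non-empty diagrams. *)
case: f1 o1 IH e1 s1 h1 => [|a' f1] [|t o1] IH e1 // s1 h1;
  case: f2 o2 e2 s2 h2 => [|b' f2] [|u o2] e2 // s2 h2.
- by move: e1; rewrite e2 /= => ->.
- have g := assemble_gt0 (f := b' :: f2) (o := o2) _ isT (ne _ (tl _ _ h2)).
  rewrite assemble_cons in e2; last exact: ne.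
  by case: (@irreducible_op u a _ _ irra b0 (g _)); [case: s2|rewrite -e2 e1].
- have g := assemble_gt0 (f := a' :: f1) (o := o1) _ isT (ne _ (tl _ _ h1)).
  rewrite assemble_cons in e1; last exact: ne.
  by case: (@irreducible_op t b _ _ irrb a0 (g _)); [case: s1|rewrite -e1 e2].
case: s1 => s1; case: s2 => s2.
have c0 := assemble_gt0 (f := a' :: f1) (o := o1) s1 isT (ne _ (tl _ _ h1)).
have d0 := assemble_gt0 (f := b' :: f2) (o := o2) s2 isT (ne _ (tl _ _ h2)).
rewrite assemble_cons in e1; last exact: ne.
rewrite assemble_cons in e2; last exact: ne.
rewrite e1 in e2.
case: (ltngtP (pd_order a) (pd_order b)) => hab.
- have [e e0 be] := pd_op_split a0 c0 d0 e2 hab.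
  by case: (irreducible_op irrb a0 _ be); rewrite Defs.order_gt0.
- have [e e0 ae] := pd_op_split b0 d0 c0 (esym e2) hab.
  by case: (irreducible_op irra b0 _ ae); rewrite Defs.order_gt0.
have [-> -> ecd] := pd_op_inj a0 c0 d0 e2 hab.
by have [-> -> ->] := IH (b' :: f2) o1 o2 _ erefl s1 (tl _ _ h1) ecd s2 (tl _ _ h2).
Qed.

(** * Factors and operations of products, and the length *)

(** The refinement attached to [p] comes from a choice; by uniqueness, exhibiting any refinement
    determines it. *)
Lemma refinement_eq p f o : is_refinement p (f, o) ->
  pd_factors p = f /\ pd_operations p = o.
Proof.
move=> h; rewrite /pd_factors /pd_operations.
by rewrite (refinement_unique (refinementP p) h).
Qed.

Lemma assemble_factors p : p = assemble (pd_factors p) (pd_operations p).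
Proof. by case: (refinementP p). Qed.

Lemma size_operations p : size (pd_operations p) = (size (pd_factors p)).-1.
Proof. by case: (refinementP p). Qed.

Lemma irreducible_factors p q : q \in pd_factors p -> irreducible q.
Proof. by case: (refinementP p) => _ _; apply. Qed.

Lemma factors_neq0 p : p != pd_empty -> pd_factors p != [::].
Proof. by apply: contraNneq => f0; rewrite (assemble_factors p) f0. Qed.

Lemma factors_empty : pd_factors pd_empty = [::].
Proof. by case: (@refinement_eq pd_empty [::] [::]). Qed.

Lemma operations_empty : pd_operations pd_empty = [::].
Proof. by case: (@refinement_eq pd_empty [::] [::]). Qed.

Lemma refinement_op t p q : p != pd_empty -> q != pd_empty ->
  pd_factors (pd_op t p q) = pd_factors p ++ pd_factors q /\
  pd_operations (pd_op t p q) = pd_operations p ++ t :: pd_operations q.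
Proof.
move=> /factors_neq0 p0 /factors_neq0 q0; apply: refinement_eq; split=> /=.
- rewrite assemble_cat ?size_operations -?assemble_factors //.
  by move=> r; rewrite mem_cat => /orP [] /irreducible_factors [].
- rewrite !size_cat /= !size_operations.
  by case: (pd_factors p) p0 (pd_factors q) q0 => [|a f] // _ [|b g] //= _; rewrite addnS.
- by move=> r; rewrite mem_cat => /orP [] /irreducible_factors.
Qed.

(** Cutting the refinement at an operation ⊗ would write [p] as a tensor product of two non-empty
    diagrams. *)
Lemma tensor_irreducible_operations p :
  tensor_irreducible p -> true \notin pd_operations p.
Proof.
move=> ip; apply/negP => /(nthP false) [i hi oi]; apply: ip.
have := size_operations p; have := assemble_factors p; have := @irreducible_factors p.
move: (pd_factors p) (pd_operations p) hi oi => f o hi oi ne e so.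
(* Counting from 0, operation [i] sits between factors [i] and [i.+1], so both sides of the cut have
   factors. *)
have lf : i.+1 < size f by rewrite -ltn_predRL -so.
have s1 : size (take i o) = (size (take i.+1 f)).-1 by rewrite !size_takel // ltnW.
have s2 : size (drop i.+1 o) = (size (drop i.+1 f)).-1 by rewrite !size_drop so -!subn1 subnAC.
have f1 : take i.+1 f != [::] by rewrite -size_eq0 size_takel // ltnW.
have f2 : drop i.+1 f != [::] by rewrite -size_eq0 size_drop subn_eq0 -ltnNge.
exists (assemble (take i.+1 f) (take i o)), (assemble (drop i.+1 f) (drop i.+1 o)); split.
- by rewrite -Defs.order_gt0 assemble_gt0 // => q /mem_take /ne [].
- by rewrite -Defs.order_gt0 assemble_gt0 // => q /mem_drop /ne [].
- rewrite -[pd_tensor]/(pd_op true) -assemble_cat // ?cat_take_drop; last by move=> q /ne [].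
  by rewrite e -{1}(cat_take_drop i o) (drop_nth false) ?oi.
Qed.

(** The ⊗-irreducible factors contain no ⊗ in their own refinements, so every ⊗ in the refinement of
    [p] joins two consecutive factors. The boolean summand counts the one factor in excess of the
    joints. *)
Lemma tensor_factorization_size p f : tensor_factorization p f ->
  size f = (p != pd_empty) + count id (pd_operations p).
Proof.
case=> -> {p}; elim: f => [|a f IH] h.
  by rewrite /= eqxx operations_empty.
have {}IH := IH (fun q qf => h q (mem_behead (s := a :: f) qf)).
have [a0 ia] := h a (mem_head _ _); have := tensor_irreducible_operations ia.
rewrite -has_pred1 has_count -leqNgt leqn0 => /eqP ca.
have {}ca : count id (pd_operations a) = 0 by rewrite -ca; apply: eq_count; case.
case: f IH {h} => [|b f] IH; first by rewrite /= pd_tensor0 a0 ca.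
have E : foldr pd_tensor pd_empty (b :: f) != pd_empty.
  (* Otherwise the induction hypothesis would give a non-empty list size 0. *)
  apply/negP => /eqP Z; move: IH; rewrite Z eqxx operations_empty //.
have [_ ->] : _ /\ pd_operations (foldr pd_tensor pd_empty (a :: b :: f)) = _ :=
  refinement_op true a0 E.
have -> : foldr pd_tensor pd_empty (a :: b :: f) != pd_empty.
  by rewrite -Defs.order_gt0 order_tensor ltn_addr // Defs.order_gt0.
by rewrite count_cat ca /=; move: IH; rewrite E /= => ->.
Qed.

Lemma pd_lengthE p : pd_length p = (p != pd_empty) + count id (pd_operations p).
Proof.
by rewrite /pd_length; case: constructive_indefinite_description => f /= /tensor_factorization_size.
Qed.

(** * Related diagrams as subsets of the positions *)

(** The upper bound on the position is absorbed by the default value [false] of [nth]. *)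
Lemma pd_SP p k : k \in pd_S p = (0 < k) && nth false (pd_operations p) k.-1.
Proof.
rewrite !inE /= mem_iota; case: k => [|k] //=; rewrite add1n ltnS -size_operations.
by case: ltnP => //= /(nth_default false) ->.
Qed.

(** This is S shifted down by one, as a subset of a finite type shared by all diagrams of a given
    [pd_sim] class. *)
Definition op_set n (o : seq bool) : {set 'I_n} := [set i : 'I_n | nth false o i].

Lemma card_op_set n (o : seq bool) : size o = n -> #|op_set n o| = count id o.
Proof.
move=> <-; rewrite -sum1_count (big_nth false) big_mkord -sum1_card.
by apply: eq_bigl => i; rewrite inE.
Qed.

Lemma op_set_inj n (o1 o2 : seq bool) :
  size o1 = n -> size o2 = n -> op_set n o1 = op_set n o2 -> o1 = o2.
Proof.
move=> s1 s2 /setP e; apply: (@eq_from_nth _ false); rewrite ?s1 ?s2 // => i hi.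
by have := e (Ordinal hi); rewrite !inE.
Qed.

Lemma pd_S_sub n p q : size (pd_operations p) = n ->
  (pd_S p `<=` pd_S q)%fset = (op_set n (pd_operations p) \subset op_set n (pd_operations q)).
Proof.
move=> sp; apply/fsubsetP/subsetP => [h i|h k].
  by rewrite !inE => hi; have := h i.+1; rewrite !pd_SP; apply.
rewrite !pd_SP; case: k => //= k hk.
have kn : k < n by rewrite -sp; apply: contraLR hk; rewrite -leqNgt => /(nth_default false) ->.
by have := h (Ordinal kn); rewrite !inE; apply.
Qed.

Lemma card_pd_S_diff n p q : size (pd_operations p) = n ->
  #|` (pd_S p `\` pd_S q)%fset| = #|op_set n (pd_operations p) :\: op_set n (pd_operations q)|.
Proof.
move=> sp; set A := _ :\: _.
rewrite cardE -(size_map (fun i : 'I_n => i.+1)); apply: perm_size.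
apply: uniq_perm; rewrite ?fset_uniq //.
  by rewrite map_inj_uniq ?enum_uniq // => i j [] /val_inj.
move=> k; rewrite in_fsetD !pd_SP; apply/idP/mapP => [|[i]]; last first.
  by rewrite mem_enum !inE => /andP [h1 h2] -> /=; rewrite h1 h2.
case: k => //= k /andP [hq hk].
have kn : k < n by rewrite -sp; apply: contraLR hk; rewrite -leqNgt => /(nth_default false) ->.
by exists (Ordinal kn); rewrite // mem_enum !inE hq.
Qed.

(** The inverse of [op_set] on the class of [p]: [codom] lists the membership bits of [T] in
    increasing order of position. *)
Definition with_ops p (T : {set 'I_(size (pd_operations p))}) : pdiag :=
  assemble (pd_factors p) (codom (fun i => i \in T)).

Lemma with_ops_refinement p T :
  pd_factors (@with_ops p T) = pd_factors p /\
  pd_operations (with_ops T) = codom (fun i => i \in T).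
Proof.
apply: refinement_eq; split=> //=; last exact: irreducible_factors.
by rewrite size_codom card_ord size_operations.
Qed.

Lemma op_set_codom n (T : {set 'I_n}) : op_set n (codom (fun i => i \in T)) = T.
Proof.
apply/setP => i; rewrite inE codomE (nth_map i) ?size_enum_ord //.
by rewrite nth_ord_enum.
Qed.

Lemma sim_size p q : pd_sim q p -> size (pd_operations q) = size (pd_operations p).
Proof. by rewrite !size_operations => /eqP ->. Qed.

Lemma op_setK p q : pd_sim q p ->
  with_ops (op_set (size (pd_operations p)) (pd_operations q)) = q.
Proof.
move=> pq; rewrite /with_ops -(eqP pq) [RHS]assemble_factors; congr assemble.
apply: (@op_set_inj (size (pd_operations p))); rewrite ?op_set_codom ?(sim_size pq) //.
by rewrite size_codom card_ord.
Qed.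

Lemma Tagged_diagram_inj k : injective (fun r : diagram k => Tagged diagram r).
Proof. by move=> r s /eqP; rewrite eq_Tagged => /eqP. Qed.

(** Since [op_set] and [with_ops] are mutually inverse, sums over the diagrams related to [p] become
    sums over all subsets. *)
Lemma sum_sim (V : nmodType) p (F : {set 'I_(size (pd_operations p))} -> V) :
  (\sum_(r : diagram (pd_order p) | pd_sim (Tagged diagram r) p)
     F (op_set (size (pd_operations p)) (pd_operations (Tagged diagram r))) = \sum_T F T)%R.
Proof.
set n := size _; pose h (r : diagram (pd_order p)) := op_set n (pd_operations (Tagged diagram r)).
pose A := [pred r : diagram (pd_order p) | pd_sim (Tagged diagram r) p].
rewrite -(@big_imset _ _ _ _ _ h A); last first.
  move=> r s rA sA hrs.
  apply: Tagged_diagram_inj; rewrite -(op_setK rA) -(op_setK sA).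
  by congr with_ops.
apply: eq_bigl => T; apply/imsetP.
have [fT oT] := with_ops_refinement T.
have sT : pd_sim (with_ops T) p by rewrite /pd_sim fT.
have [r er] : exists r : diagram (pd_order p), with_ops T = Tagged diagram r.
  by rewrite -(pd_sim_order sT); case: (with_ops T) => k r; exists r.
by exists r; rewrite ?inE /h -er ?oT ?op_set_codom.
Qed.

Local Open Scope ring_scope.

(** * Signed sums over subsets *)

(** Expand the product of the [F i + 1]: the choices of [F i] form a set [T], and only [T] inside
    [B] survive. The factor is 2 on the elements of [B] in [A], 0 on those of [B] outside [A], and 1
    elsewhere. *)
Lemma sum_sign_subset (R : comPzRingType) (I : finType) (A B : {set I}) :
  \sum_(T : {set I} | T \subset B) (-1) ^+ #|T :\: A| =
  (if B \subset A then 2%:R ^+ #|B| else 0) :> R.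
Proof.
pose F i : R := if i \in B then (if i \in A then 1 else -1) else 0.
transitivity (\prod_i (F i + 1)); last first.
  case: ifPn => [/subsetP BA|/subsetPn [i iB iA]]; last first.
    by rewrite (bigD1 i) //= /F iB (negbTE iA) addNr mul0r.
  rewrite -prodr_const [RHS]big_mkcond; apply: eq_bigr => i _; rewrite /F.
  by case: ifP => [/BA ->|_]; rewrite ?add0r.
rewrite bigA_distr big_mkcond; apply: eq_bigr => T _; case: ifPn => [/subsetP TB|/subsetPn [i iT iB]].
  rewrite -prodr_const big_mkcond; apply: eq_bigr => i _; rewrite inE.
  by case: (boolP (i \in T)) => iT; rewrite ?andbF ?andbT // /F TB //; case: (i \in A).
by rewrite (bigD1 i) //= iT /F (negbTE iB) mul0r.
Qed.

(** Complementation reduces this to [sum_sign_subset], because [A :\: T] equals [~: T :\: ~: A]. *)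
Lemma sum_sign_supset (R : comPzRingType) (I : finType) (A B : {set I}) :
  \sum_(T : {set I} | B \subset T) (-1) ^+ #|A :\: T| =
  (if A \subset B then 2%:R ^+ #|~: B| else 0) :> R.
Proof.
rewrite -setCS -sum_sign_subset (reindex_inj (inv_inj (@setCK I))).
by apply: eq_big => [T|T _]; [rewrite subsetC|rewrite !setDE !setCK setIC].
Qed.

(** Identity (1) on sets. After exchanging the sums, the coefficient of [m T] is the signed count
    over the subsets of [T]. *)
Lemma signed_sum_supset (K : comPzRingType) (V : lmodType K) (I : finType)
    (m : {set I} -> V) (A : {set I}) :
  \sum_R (-1) ^+ #|R :\: A| *: \sum_(T : {set I} | R \subset T) m T =
  \sum_(T : {set I} | T \subset A) 2%:R ^+ #|T| *: m T.
Proof.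
under eq_bigr => R _ do rewrite scaler_sumr.
rewrite (exchange_big_dep predT) //= [RHS]big_mkcond; apply: eq_bigr => T _.
by rewrite -scaler_suml sum_sign_subset; case: ifP; rewrite ?scale0r.
Qed.

(** Identity (2) on sets. The coefficient of [m T] is [2 ^ #|T|] times the signed count over the
    supersets of [T], and the two powers of 2 multiply to [2 ^ #|I|]. *)
Lemma signed_sum_subset (K : comPzRingType) (V : lmodType K) (I : finType)
    (m : {set I} -> V) (A : {set I}) :
  \sum_R (-1) ^+ #|A :\: R| *: \sum_(T : {set I} | T \subset R) 2%:R ^+ #|T| *: m T =
  2%:R ^+ #|I| *: \sum_(T : {set I} | A \subset T) m T.
Proof.
under eq_bigr => R _ do rewrite scaler_sumr.
rewrite (exchange_big_dep predT) //= scaler_sumr [RHS]big_mkcond; apply: eq_bigr => T _.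
under eq_bigr => R _ do rewrite scalerA.
rewrite -scaler_suml -mulr_suml sum_sign_supset; case: ifP; rewrite ?mul0r ?scale0r // => _.
by rewrite -exprD addnC cardsC.
Qed.

(** * Transfer of the set identities to diagrams *)

Lemma sim_trans r s p : pd_sim r p -> pd_sim s r = pd_sim s p.
Proof. by rewrite /pd_sim => /eqP ->. Qed.

Lemma simC p q : pd_sim p q = pd_sim q p.
Proof. exact: eq_sym. Qed.

(** The order on diagrams reverses inclusion of the sets S, so going down means taking supersets.
    All sets are taken relative to a fixed [p] in the class. *)
Lemma L_E (K : fieldType) p (r : diagram (pd_order p)) :
  pd_sim (Tagged diagram r) p ->
  L_ K (Tagged diagram r) =
  \sum_(T : {set _} | op_set (size (pd_operations p)) (pd_operations (Tagged diagram r)) \subset T)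
     M_ K (with_ops T).
Proof.
move=> rp; rewrite big_mkcond -sum_sim /L_ -big_mkcondr.
apply: eq_big => [s|s]; rewrite /pd_le (sim_trans _ rp).
  by case: (boolP (pd_sim _ p)) => //= _; rewrite (pd_S_sub _ (sim_size rp)).
by case/andP=> sp _; rewrite op_setK.
Qed.

(** The factor 2 in front comes from l = |S| + 1, valid for non-empty diagrams. *)
Lemma eta_E (K : fieldType) p (r : diagram (pd_order p)) : p != pd_empty ->
  pd_sim (Tagged diagram r) p ->
  eta_ K (Tagged diagram r) =
  2%:R *: \sum_(T : {set _} | T \subset op_set (size (pd_operations p)) (pd_operations (Tagged diagram r)))
     2%:R ^+ #|T| *: M_ K (with_ops T).
Proof.
move=> p0 rp; rewrite scaler_sumr big_mkcond -sum_sim /eta_ -big_mkcondr.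
apply: eq_big => [s|s]; rewrite /pd_le simC (sim_trans _ rp).
  case: (boolP (pd_sim _ p)) => //= sp.
  by rewrite (pd_S_sub _ (sim_size sp)).
case/andP=> sp _; rewrite op_setK // scalerA -exprS card_op_set ?(sim_size sp) //.
have s0 : Tagged diagram s != pd_empty by move: p0; rewrite !pd_emptyE.
by rewrite pd_lengthE s0.
Qed.

Lemma eta_L_empty (K : fieldType) : eta_ K pd_empty = L_ K pd_empty.
Proof.
rewrite /eta_ /L_; apply: eq_big => [s|s _].
  have -> : Tagged diagram s = pd_empty by apply/eqP; rewrite pd_emptyE.
  by [].
have -> : Tagged diagram s = pd_empty by apply/eqP; rewrite pd_emptyE.
by rewrite pd_lengthE eqxx operations_empty expr0 scale1r.
Qed.

(** The empty diagram is excluded from (1): there l = 0 gives [eta_] = [L_] = [M_], and (1) would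
    say that [M_] equals its double, which is false over a field. *)
Theorem proposition8p1 (K : fieldType) (two_unit : (2%:R : K) \is a GRing.unit) :
  (forall p : pdiag, p != pd_empty ->
     eta_ K p = 2%:R *: \sum_(r : diagram (pd_order p) | pd_sim (Tagged diagram r) p)
       (-1) ^+ #|` pd_S (Tagged diagram r) `\` pd_S p|%fset *: L_ K (Tagged diagram r))
  /\
  (forall (n : nat) (p : pdiag), p \in pd_I n ->
     L_ K p = 2%:R ^- n *: \sum_(r : diagram (pd_order p) | pd_sim (Tagged diagram r) p)
       (-1) ^+ #|` pd_S p `\` pd_S (Tagged diagram r)|%fset *: eta_ K (Tagged diagram r)).
Proof.
have self p : exists2 r : diagram (pd_order p), Tagged diagram r = p & pd_sim (Tagged diagram r) p.
  by case: p => k r; exists r; rewrite /pd_sim.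
split=> [p p0|n p /eqP np].
  have [r0 er0 r0p] := self p; rewrite -{1}er0 (eta_E _ p0 r0p) er0; congr (_ *: _).
  rewrite -signed_sum_supset -sum_sim; apply: eq_bigr => r rp.
  by rewrite (L_E _ rp) (card_pd_S_diff _ (sim_size rp)).
case: (eqVneq p pd_empty) np => [-> <-|p0 np].
  (* For the empty diagram n = 0 and the sum has a single term. *)
  rewrite factors_empty expr0 invr1 scale1r.
  have e (s : diagram (pd_order pd_empty)) : Tagged diagram s = pd_empty.
    by apply/eqP; rewrite pd_emptyE.
  rewrite (big_pred1 (tagged pd_empty)) => [|s].
    by rewrite e fsetDv cardfs0 expr0 scale1r eta_L_empty.
  by rewrite /= (@Tagged_diagram_inj _ s (tagged pd_empty)) ?e // /pd_sim !eqxx.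
have [r0 er0 r0p] := self p.
(* The right-hand side on sets, with the factor 2 of [eta_E] pulled out. *)
transitivity (2%:R ^- n *: (2%:R *: \sum_R (-1) ^+
    #|op_set (size (pd_operations p)) (pd_operations p) :\: R| *:
    \sum_(T : {set _} | T \subset R) 2%:R ^+ #|T| *: M_ K (with_ops T))).
  rewrite signed_sum_subset card_ord !scalerA -mulrA -exprS.
  (* There are n - 1 operations, and the extra factor 2 completes the power to [2 ^ n], which is
     then inverted. *)
  have -> : (size (pd_operations p)).+1 = n.
    by rewrite size_operations np prednK // -np lt0n size_eq0 factors_neq0.
  by rewrite mulVr ?unitrX // scale1r -{1}er0 (L_E _ r0p) er0.
congr (_ *: _); rewrite scaler_sumr -sum_sim; apply: eq_bigr => r rp.
by rewrite (eta_E _ p0 rp) (card_pd_S_diff _ erefl) !scalerA mulrC.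
Qed.
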